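(* Let $(G,B,w)$ be a finite weighted graph with boundary $B$ and interior $\Omega=V(G)\setminus B$, and let $k\ge0$. The Dirichlet-to-Neumann maps $T^{(k)}_{\delta d}$, $T^{(k)}_{d\delta}$ and $T^{(k)}$ are all nonnegative self-adjoint operators on $A^k(\partial\Omega)$ (with respect to $\langle\cdot,\cdot\rangle_{\partial\Omega}$). Moreover, $$\ker T^{(k)}_{\delta d}=\{\omega|_{C_{k+1}(\partial\Omega)}\ :\ \omega\in A^k(G)\text{ with }d\omega=0\text{ on }G\},$$ $$\ker T^{(k)}_{d\delta}=\{\omega|_{C_{k+1}(\partial\Omega)}\ :\ \omega\in A^k(G)\text{ with }\delta\omega=0\text{ on }\Omega\},$$ $$\ker T^{(k)}=\{\omega|_{C_{k+1}(\partial\Omega)}\ :\ \omega\in A^k(G)\text{ with }d\omega=0\text{ on }G\text{ and }\delta\omega=0\text{ on }\Omega\}.$$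
   Context: All graphs are simple. $V(G),E(G)$ are the vertex and edge sets. A $k$-clique of $G$ is a set of $k$ distinct pairwise adjacent vertices; $C_k(G)$ is the set of $k$-cliques. A $k$-form on $G$ ($k\ge 0$) is a function $f:V(G)^{k+1}\to\mathbb{R}$ that is skew-symmetric in its variables and satisfies $f(v_0,\dots,v_k)=0$ whenever $\{v_0,\dots,v_k\}\notin C_{k+1}(G)$; $A^k(G)$ is the space of $k$-forms. The exterior differential $d:A^k(G)\to A^{k+1}(G)$ is $d\alpha(v_0,\dots,v_{k+1})=\sum_{j=0}^{k+1}(-1)^j\alpha(v_0,\dots,\hat v_j,\dots,v_{k+1})$ if $\{v_0,\dots,v_{k+1}\}\in C_{k+2}(G)$, and $0$ otherwise. A weight $w$ on $G$ assigns, for every $k\ge0$, to each $(v_0,\dots,v_k)\in V(G)^{k+1}$ a real number $w(v_0,\dots,v_k)$, symmetric in the variables, positive if $\{v_0,\dots,v_k\}\in C_{k+1}(G)$ and $0$ otherwise. For finite $G$, $\langle\alpha,\beta\rangle_G=\frac1{(k+1)!}\sum_{v_0,\dots,v_k\in V(G)}\alpha(v_0,\dots,v_k)\beta(v_0,\dots,v_k)w(v_0,\dots,v_k)$ is the inner product on $A^k(G)$, $\delta:A^{k+1}(G)\to A^k(G)$ is the adjoint of $d$ (with $\delta=0$ on $A^0(G)$), and $\Delta=d\delta+\delta d$. A graph with boundary $(G,B)$ is a simple graph $G$ with $B\subset V(G)$ such that no two vertices of $B$ are adjacent and every vertex of $B$ is adjacent to some vertex of $\Omega:=V(G)\setminus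 B$ (the interior). $C_{k+1}(\partial\Omega)$ is the set of $(k+1)$-cliques of $G$ with exactly one vertex in $B$ and the remaining $k$ vertices in $\Omega$. $A^k(\partial\Omega)$ is the space of functions $f:B\times\Omega^k\to\mathbb{R}$, skew-symmetric in the last $k$ variables, with $f(v_0,\dots,v_k)=0$ when $\{v_0,\dots,v_k\}\notin C_{k+1}(\partial\Omega)$. Its inner product is $\langle\alpha,\beta\rangle_{\partial\Omega}=\frac1{k!}\sum_{v\in B}\sum_{v_1,\dots,v_k\in\Omega}\alpha(v,v_1,\dots,v_k)\beta(v,v_1,\dots,v_k)w(v,v_1,\dots,v_k)$. For $\omega\in A^k(G)$, $\omega|_{C_{k+1}(\partial\Omega)}\in A^k(\partial\Omega)$ is its restriction to $B\times\Omega^k$. For a form $\theta\in A^k(G)$, ''$\theta=0$ in (on) $\Omega$'' means that $\theta$ vanishes on every $(k+1)$-clique of $G$ contained in $\Omega$; ''$\omega=\varphi$ on $C_{k+1}(\partial\Omega)$'' means that $\omega|_{C_{k+1}(\partial\Omega)}=\varphi$. For $\alpha\in A^{k+1}(G)$, $\mathbf{N}\alpha\in A^k(\partial\Omega)$ is $\mathbf{N}\alpha(v,v_1,\dots,v_k)=\frac{1}{w(v,v_1,\dots,v_k)}\sum_{u\in\Omega}\alpha(u,v,v_1,\dots,v_k)w(u,v,v_1,\dots,v_k)$, and for $\alpha\in A^{k-1}(G)$ ($k\ge1$), $\mathbf{D}\alpha\in A^k(\partial\Omega)$ is $\mathbf{D}\alpha(v,v_1,\dots,v_k)=\alpha(v_1,\dots,v_k)$,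 whenever $\{v,v_1,\dots,v_k\}\in C_{k+1}(\partial\Omega)$, $v\in B$ (and $0$ otherwise). Dirichlet-to-Neumann maps: for $\varphi\in A^k(\partial\Omega)$ let $E^{(k)}_{\delta d}(\varphi)$, $E^{(k)}_{d\delta}(\varphi)$, $E^{(k)}(\varphi)\in A^k(G)$ be any solutions $\omega$ of, respectively, $\delta d\omega=0$ in $\Omega$, $d\delta\omega=0$ in $\Omega$, $\Delta\omega=0$ in $\Omega$, each with $\omega=\varphi$ on $C_{k+1}(\partial\Omega)$ (solutions exist). Then $T^{(k)}_{\delta d}(\varphi)=\mathbf{N}(dE^{(k)}_{\delta d}(\varphi))$, $T^{(k)}_{d\delta}(\varphi)=\mathbf{D}(\delta E^{(k)}_{d\delta}(\varphi))$, $T^{(k)}(\varphi)=\mathbf{N}(dE^{(k)}(\varphi))+\mathbf{D}(\delta E^{(k)}(\varphi))$; these do not depend on the choice of solutions. For $k=0$ the terms involving $\mathbf{D}\delta$ are zero. *)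

(* Defs.v *)
From HB Require Import structures.
From mathcomp Require Import all_boot all_order all_fingroup all_algebra.
From mathcomp Require Import boolp classical_sets reals.

Set Implicit Arguments.
Unset Strict Implicit.
Unset Printing Implicit Defensive.

Import Order.TTheory GRing.Theory Num.Theory.

Local Open Scope ring_scope.

(** * Graphs, cliques, weights *)

Record sgraph := SGraph {
  vertex :> finType;
  adj : rel vertex;
  adj_sym : symmetric adj;
  adj_irr : irreflexive adj }.

(* C_n(G) *)
Definition cliques (G : sgraph) (n : nat) : {set {set G}} :=
  [set A : {set G} | (#|A| == n)
     && [forall x in A, forall y in A, (x != y) ==> adj x y]].

Definition reorder n T (s : 'S_n) (v : n.-tuple T) : n.-tuple T :=
  [tuple tnth v (s i) | i < n].

(* (v_0, .., \hat v_j, .., v_n) *)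
Definition omit n T (j : 'I_n.+1) (v : n.+1.-tuple T) : n.-tuple T :=
  [tuple tnth v (lift j i) | i < n].

Record weight (R : realType) (G : sgraph) := Weight {
  weight_fun :> forall k, k.+1.-tuple G -> R;
  weight_sym : forall k (s : 'S_k.+1) (v : k.+1.-tuple G),
    weight_fun (reorder s v) = weight_fun v;
  weight_pos : forall k (v : k.+1.-tuple G),
    [set x in v] \in cliques G k.+1 -> 0 < weight_fun v;
  weight_eq0 : forall k (v : k.+1.-tuple G),
    [set x in v] \notin cliques G k.+1 -> weight_fun v = 0 }.

Record bgraph := BGraph {
  bgraph_graph :> sgraph;
  bdry : {set bgraph_graph};
  bdry_indep : {in bdry &, forall x y, ~~ adj x y};
  bdry_adj : {in bdry, forall x, exists2 y, y \notin bdry & adj x y} }.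

Definition Omega (G : bgraph) : {set G} := ~: bdry G.

(* C_n(\partial\Omega) *)
Definition bcliques (G : bgraph) (n : nat) : {set {set G}} :=
  [set A in cliques G n | (#|A :&: bdry G| == 1%N)
                       && (#|A :&: Omega G| == n.-1)].

Definition bvertex (G : bgraph) := {x : G | x \in bdry G}.
Definition ivertex (G : bgraph) := {x : G | x \in Omega G}.
HB.instance Definition _ (G : bgraph) := Finite.on (bvertex G).
HB.instance Definition _ (G : bgraph) := Finite.on (ivertex G).

(* the inclusion of B x \Omega^k into V(G)^(k+1) *)
Definition bargs (G : bgraph) k (v : bvertex G) (vs : k.-tuple (ivertex G)) :
    k.+1.-tuple G :=
  cons_tuple (val v) (map_tuple val vs).

(** * Reordering of arguments *)

Lemma reorder_set (T : finType) n (s : 'S_n) (v : n.-tuple T) :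
  [set x in reorder s v] = [set x in v].
Proof.
apply/setP => x; rewrite !inE; apply/tnthP/tnthP => -[i ->].
  by exists (s i); rewrite tnth_mktuple.
by exists ((s^-1)%g i); rewrite tnth_mktuple permKV.
Qed.

Lemma reorder_cons T n (s : 'S_n) (u : T) (v : n.-tuple T) :
  cons_tuple u (reorder s v) = reorder (lift_perm ord0 ord0 s) (cons_tuple u v).
Proof.
apply: eq_from_tnth => i; rewrite tnth_mktuple.
case: (unliftP ord0 i) => [j|] ->; last by rewrite lift_perm_id !tnth0.
by rewrite lift_perm_lift !tnthS tnth_mktuple.
Qed.

Lemma reorder_map T U n (s : 'S_n) (f : T -> U) (v : n.-tuple T) :
  map_tuple f (reorder s v) = reorder s (map_tuple f v).
Proof. by apply: eq_from_tnth => i; rewrite tnth_map !tnth_mktuple tnth_map. Qed.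

Lemma reorder_bargs (G : bgraph) k (s : 'S_k) v (vs : k.-tuple (ivertex G)) :
  bargs v (reorder s vs) = reorder (lift_perm ord0 ord0 s) (bargs v vs).
Proof. by rewrite /bargs reorder_map reorder_cons. Qed.

Lemma lift_perm_omit n (s : 'S_n.+1) (j : 'I_n.+1) :
  {t : 'S_n | s = lift_perm j (s j) t}.
Proof.
pose f k := odflt k (unlift (s j) (s (lift j k))).
have fK k : lift (s j) (f k) = s (lift j k).
  rewrite /f; case: unliftP => [k' -> //|/perm_inj/eqP].
  by rewrite eq_sym (negPf (neq_lift _ _)).
have f_inj : injective f.
  by move=> k l /(congr1 (lift (s j))); rewrite !fK => /perm_inj/lift_inj.
exists (perm f_inj); apply/permP => i.
case: (unliftP j i) => [k|] ->; last by rewrite lift_perm_id.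
by rewrite lift_perm_lift permE fK.
Qed.

Lemma omit_reorder T n (s : 'S_n.+1) t (j : 'I_n.+1) (v : n.+1.-tuple T) :
  s = lift_perm j (s j) t -> omit j (reorder s v) = reorder t (omit (s j) v).
Proof.
move=> st; apply: eq_from_tnth => i.
by rewrite !tnth_mktuple {1}st lift_perm_lift.
Qed.

(** * Differential forms *)

Section Forms.
Variables (R : realType) (G : sgraph) (k : nat).

Definition form_pred : {pred {ffun k.+1.-tuple G -> R^o}} :=
  [pred f : {ffun k.+1.-tuple G -> R^o} |
  [forall s : 'S_k.+1, forall v, f (reorder s v) == (-1) ^+ s * f v] &&
  [forall v : k.+1.-tuple G, ([set x in v] \notin cliques G k.+1) ==> (f v == 0)]].

Lemma form_predP (f : {ffun k.+1.-tuple G -> R^o}) :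
  reflect ((forall (s : 'S_k.+1) v, f (reorder s v) = (-1) ^+ s * f v) /\
           (forall v : k.+1.-tuple G, [set x in v] \notin cliques G k.+1 -> f v = 0))
          (f \in form_pred).
Proof.
apply: (iffP andP) => -[skew supp]; split.
- by move=> s v; apply/eqP; move/forallP/(_ s)/forallP: skew.
- by move=> v nv; apply/eqP; move/forallP/(_ v)/implyP: supp; apply.
- by apply/forallP => s; apply/forallP => v; rewrite skew.
- by apply/forallP => v; apply/implyP => /supp ->.
Qed.

Lemma form_pred_submod : submod_closed form_pred.
Proof.
split=> [|a f g /form_predP[fs f0] /form_predP[gs g0]]; apply/form_predP; split.
- by move=> s v; rewrite !ffunE mulr0.
- by move=> v _; rewrite ffunE.
- by move=> s v; rewrite !ffunE fs gs /= mulrDr [a *: (_ * _)]mulrCA.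
- by move=> v nv; rewrite !ffunE f0 // g0 // scaler0 addr0.
Qed.
HB.instance Definition _ :=
  GRing.isSubmodClosed.Build R {ffun k.+1.-tuple G -> R^o} form_pred form_pred_submod.

(* A^k(G) *)
Record kform := Form {
  form_val :> {ffun k.+1.-tuple G -> R^o};
  form_valP : form_val \in form_pred }.

HB.instance Definition _ := [isSub for form_val].
HB.instance Definition _ := [Choice of kform by <:].
HB.instance Definition _ := [SubChoice_isSubLmodule of kform by <:].

End Forms.

Arguments kform R G k : clear implicits.

Section BoundaryForms.
Variables (R : realType) (G : bgraph) (k : nat).

Definition bform_pred : {pred {ffun bvertex G * k.-tuple (ivertex G) -> R^o}} :=
  [pred f : {ffun bvertex G * k.-tuple (ivertex G) -> R^o} |
  [forall s : 'S_k, forall v, forall vs,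
     f (v, reorder s vs) == (-1) ^+ s * f (v, vs)] &&
  [forall v, forall vs : k.-tuple (ivertex G),
     ([set x in bargs v vs] \notin bcliques G k.+1) ==> (f (v, vs) == 0)]].

Lemma bform_predP (f : {ffun bvertex G * k.-tuple (ivertex G) -> R^o}) :
  reflect ((forall (s : 'S_k) v vs, f (v, reorder s vs) = (-1) ^+ s * f (v, vs)) /\
           (forall v (vs : k.-tuple (ivertex G)),
              [set x in bargs v vs] \notin bcliques G k.+1 -> f (v, vs) = 0))
          (f \in bform_pred).
Proof.
apply: (iffP andP) => -[skew supp]; split.
- by move=> s v vs; apply/eqP; move/forallP/(_ s)/forallP/(_ v)/forallP: skew.
- move=> v vs nv; apply/eqP.
  by move/forallP/(_ v)/forallP/(_ vs)/implyP: supp; apply.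
- by apply/forallP => s; apply/forallP => v; apply/forallP => vs; rewrite skew.
- by apply/forallP => v; apply/forallP => vs; apply/implyP => /supp ->.
Qed.

Lemma bform_pred_submod : submod_closed bform_pred.
Proof.
split=> [|a f g /bform_predP[fs f0] /bform_predP[gs g0]]; apply/bform_predP; split.
- by move=> s v vs; rewrite !ffunE mulr0.
- by move=> v vs _; rewrite ffunE.
- by move=> s v vs; rewrite !ffunE fs gs /= mulrDr [a *: (_ * _)]mulrCA.
- by move=> v vs nv; rewrite !ffunE f0 // g0 // scaler0 addr0.
Qed.
HB.instance Definition _ :=
  GRing.isSubmodClosed.Build R {ffun bvertex G * k.-tuple (ivertex G) -> R^o}
    bform_pred bform_pred_submod.

(* A^k(\partial\Omega) *)
Record bkform := BForm {
  bform_val :> {ffun bvertex G * k.-tuple (ivertex G) -> R^o};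
  bform_valP : bform_val \in bform_pred }.

HB.instance Definition _ := [isSub for bform_val].
HB.instance Definition _ := [Choice of bkform by <:].
HB.instance Definition _ := [SubChoice_isSubLmodule of bkform by <:].

End BoundaryForms.

Arguments bkform R G k : clear implicits.

(** * Exterior differential and its adjoint *)

Section Differential.
Variables (R : realType) (G : sgraph) (k : nat).

Definition diff_fun (a : kform R G k) : {ffun k.+2.-tuple G -> R^o} :=
  [ffun v : k.+2.-tuple G => if [set x in v] \in cliques G k.+2
             then \sum_(j < k.+2) (-1) ^+ j * a (omit j v) else 0].

Lemma diff_subproof a : diff_fun a \in @form_pred R G k.+1.
Proof.
have [askew _] := form_predP _ (form_valP a).
apply/form_predP; split=> [s v|v /negPf nv]; last by rewrite ffunE nv.
rewrite !ffunE reorder_set; case: ifP => _; last by rewrite mulr0.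
rewrite mulr_sumr [RHS](reindex_inj (@perm_inj _ s)) /=.
apply: eq_bigr => j _; have [t st] := lift_perm_omit s j.
rewrite (omit_reorder _ st) askew /=.
have -> : (-1) ^+ s = (-1) ^+ j * (-1) ^+ s j * (-1) ^+ t :> R.
  by rewrite st odd_lift_perm !signr_addb !signr_odd -st.
rewrite -!mulrA; congr (_ * _); rewrite mulrCA; congr (_ * _).
by rewrite mulrA -expr2 sqrr_sign mul1r.
Qed.

Definition ext_diff (a : kform R G k) : kform R G k.+1 := Form (diff_subproof a).

Definition inner (w : weight R G) (a b : kform R G k) : R :=
  (k.+1)`!%:R^-1 * \sum_(v : k.+1.-tuple G) a v * b v * w k v.

End Differential.

(* \delta \alpha is the form \beta with <\beta, \gamma> = <\alpha, d \gamma> for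
   all \gamma. *)
Definition codiff (R : realType) (G : sgraph) (w : weight R G) k
    (a : kform R G k.+1) : kform R G k :=
  xget 0 [set b | forall c, inner w b c = inner w a (ext_diff c)]%classic.

Definition delta_d (R : realType) (G : sgraph) (w : weight R G) k
    (a : kform R G k) : kform R G k :=
  codiff w (ext_diff a).

Definition d_delta (R : realType) (G : sgraph) (w : weight R G) k :
    kform R G k -> kform R G k :=
  if k is k'.+1 then fun a => ext_diff (codiff w a) else fun=> 0.

Definition laplacian (R : realType) (G : sgraph) (w : weight R G) k
    (a : kform R G k) : kform R G k :=
  d_delta w a + delta_d w a.

(** * Boundary operators *)

Section Boundary.
Variables (R : realType) (G : bgraph) (w : weight R G).

Definition binner k (a b : bkform R G k) : R :=
  k`!%:R^-1 * \sum_(v : bvertex G) \sum_(vs : k.-tuple (ivertex G))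
    a (v, vs) * b (v, vs) * w k (bargs v vs).

Lemma bcliques_bargs k (v : bvertex G) (vs : k.-tuple (ivertex G)) :
  ([set x in bargs v vs] \in bcliques G k.+1) =
  ([set x in bargs v vs] \in cliques G k.+1).
Proof.
rewrite [LHS]inE andb_idr // inE => /andP[/eqP cardA _].
have vsI : {in map_tuple val vs, forall x, x \in Omega G}.
  by move=> _ /mapP[y _ ->]; apply: (valP y).
have bdE : [set x in bargs v vs] :&: bdry G = [set val v].
  apply/setP => x; rewrite !inE; case: eqP => [->|_] /=; first exact: (valP v).
  by apply/negP => /andP[/vsI]; rewrite inE => /negP.
rewrite bdE cards1 eqxx /=.
have := cardsID (bdry G) [set x in bargs v vs].
by rewrite bdE cards1 cardA /Omega -finset.setDE add1n => -[->].
Qed.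

Definition restr_fun k (a : kform R G k) :
    {ffun bvertex G * k.-tuple (ivertex G) -> R^o} :=
  [ffun p => a (bargs p.1 p.2)].

Lemma restr_subproof k (a : kform R G k) : restr_fun a \in @bform_pred R G k.
Proof.
have [askew a0] := form_predP _ (form_valP a).
apply/bform_predP; split=> [s v vs|v vs]; rewrite !ffunE /=.
  by rewrite reorder_bargs askew odd_lift_perm addbb addFb.
by rewrite bcliques_bargs => /a0.
Qed.

(* \omega|_{C_{k+1}(\partial\Omega)} *)
Definition restr_bdry k (a : kform R G k) : bkform R G k := BForm (restr_subproof a).

Definition Nop_fun k (a : kform R G k.+1) :
    {ffun bvertex G * k.-tuple (ivertex G) -> R^o} :=
  [ffun p => if [set x in bargs p.1 p.2] \in bcliques G k.+1
     then (w k (bargs p.1 p.2))^-1 *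
          \sum_(u in Omega G) a (cons_tuple u (bargs p.1 p.2))
                                 * w k.+1 (cons_tuple u (bargs p.1 p.2))
     else 0].

Lemma Nop_subproof k (a : kform R G k.+1) : Nop_fun a \in @bform_pred R G k.
Proof.
have [askew _] := form_predP _ (form_valP a).
apply/bform_predP; split=> [s v vs|v vs /negPf nv]; rewrite !ffunE /=; last by rewrite nv.
rewrite reorder_bargs reorder_set; case: ifP => _; last by rewrite mulr0.
rewrite weight_sym [RHS]mulrCA; congr (_ * _); rewrite mulr_sumr.
apply: eq_bigr => u _; rewrite reorder_cons askew weight_sym.
by rewrite !odd_lift_perm !addbb !addFb mulrA.
Qed.

Definition Nop k (a : kform R G k.+1) : bkform R G k := BForm (Nop_subproof a).

Definition Dop_fun k (a : kform R G k) :
    {ffun bvertex G * k.+1.-tuple (ivertex G) -> R^o} :=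
  [ffun p => if [set x in bargs p.1 p.2] \in bcliques G k.+2
     then a (map_tuple val p.2) else 0].

Lemma Dop_subproof k (a : kform R G k) : Dop_fun a \in @bform_pred R G k.+1.
Proof.
have [askew _] := form_predP _ (form_valP a).
apply/bform_predP; split=> [s v vs|v vs /negPf nv]; rewrite !ffunE /=; last by rewrite nv.
rewrite reorder_bargs reorder_set; case: ifP => _; last by rewrite mulr0.
by rewrite reorder_map askew.
Qed.

Definition Dop k (a : kform R G k) : bkform R G k.+1 := BForm (Dop_subproof a).

Definition D_delta k : kform R G k -> bkform R G k :=
  if k is k'.+1 then fun a => Dop (codiff w a) else fun=> 0.

Definition zero_in k (a : kform R G k) : Prop :=
  forall v : k.+1.-tuple G, [set x in v] \in cliques G k.+1 ->
    [set x in v] \subset Omega G -> a v = 0.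

(* "\delta \omega = 0 on \Omega"; vacuous for k = 0, where \delta = 0 *)
Definition coclosed_in k : kform R G k -> Prop :=
  if k is k'.+1 then fun a => zero_in (codiff w a) else fun=> True.

(** * Dirichlet-to-Neumann maps *)

(* A solution of each boundary value problem; the value 0 is used only if there
   is none. *)
Definition E_delta_d k (phi : bkform R G k) : kform R G k :=
  xget 0 [set a | zero_in (delta_d w a) /\ restr_bdry a = phi]%classic.

Definition E_d_delta k (phi : bkform R G k) : kform R G k :=
  xget 0 [set a | zero_in (d_delta w a) /\ restr_bdry a = phi]%classic.

Definition E_laplacian k (phi : bkform R G k) : kform R G k :=
  xget 0 [set a | zero_in (laplacian w a) /\ restr_bdry a = phi]%classic.

Definition T_delta_d k (phi : bkform R G k) : bkform R G k :=
  Nop (ext_diff (E_delta_d phi)).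

Definition T_d_delta k (phi : bkform R G k) : bkform R G k :=
  D_delta (E_d_delta phi).

Definition T_laplacian k (phi : bkform R G k) : bkform R G k :=
  Nop (ext_diff (E_laplacian phi)) + D_delta (E_laplacian phi).

Definition nonneg_self_adjoint k (T : bkform R G k -> bkform R G k) : Prop :=
  [/\ linear T,
      forall phi psi, binner (T phi) psi = binner phi (T psi) &
      forall phi, 0 <= binner (T phi) phi].

Definition op_kernel k (T : bkform R G k -> bkform R G k) : set (bkform R G k) :=
  [set phi | T phi = 0]%classic.

End Boundary.

(* Main.v *)
From HB Require Import structures.
Require Import Defs.
From mathcomp Require Import all_boot all_order all_fingroup all_algebra.
From mathcomp Require Import boolp classical_sets reals.

(* Each of the three maps has the form [phi |-> (L a)|_bd], where [a] solves
   [L a = 0] in Omega with [a|_bd = phi], and [L] is symmetric and nonnegative on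
   A^k(G): [L = delta d], [L = d t delta], or their sum, where [t] sets a form to
   zero off Omega.  Indeed [N] is the restriction of [delta] and [D b] is the
   restriction of [d (t b)].  Since [L a] lives on the boundary cliques,
   <T phi, psi>_bd = <L a, b>_G for the solutions [a], [b] with data [phi], [psi];
   this gives symmetry and nonnegativity, and [T phi = 0] forces <L a, a>_G = 0,
   hence [L a = 0] by Cauchy-Schwarz.  Existence of solutions is an orthogonal
   projection for the degenerate form <L . , . >_G along the forms with zero
   restriction, starting from any extension of [phi]. *)

Set Implicit Arguments.
Unset Strict Implicit.
Unset Printing Implicit Defensive.

Import Order.TTheory GRing.Theory Num.Theory.

Local Open Scope ring_scope.

(** * Finite generation through an injection into a finite-dimensional space *)

Section Generators.
Variables (R : realFieldType) (V : lmodType R) (vT : vectType R).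
Variables (i : {linear V -> vT}) (P : V -> Prop).
Hypothesis i_inj : injective i.

(** A list in [P] with free image under [i] is no longer than the dimension of [vT]. For a list of
    maximal length, the image of every element of [P] falls in the span, and injectivity pulls the
    coordinates back. *)
Lemma finite_generators : exists2 s : seq V, forall e, e \in s -> P e &
  forall x, P x -> exists c : 'I_(size s) -> R, x = \sum_j c j *: s`_j.
Proof.
pose good n := `[< exists s : seq V, [/\ size s = n, free (map i s) &
                                         forall e, e \in s -> P e] >].
have good_le n : good n -> (n <= \dim {:vT})%N.
  case/asboolP => s [<- s_free _].
  by move: s_free; rewrite /free size_map => /eqP <-; exact/dimvS/subvf.
have good0 : good 0%N by apply/asboolP; exists [::]; split=> //; exact: nil_free.
have [n /asboolP[s [size_s s_free Ps]] n_max] :=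
  ex_maxnP (ex_intro (fun n => good n) _ good0) good_le.
exists s => // x Px.
have : i x \in <<map_tuple i (in_tuple s)>>%VS.
  apply: contraT => ix; suff: (n.+1 <= n)%N by rewrite ltnn.
  apply: n_max; apply/asboolP; exists (x :: s); split.
  - by rewrite /= size_s.
  - by rewrite /= free_cons ix.
  - by move=> e; rewrite inE => /predU1P[->|/Ps].
move/coord_span => ix.
exists (fun j => coord (map_tuple i (in_tuple s)) j (i x)).
apply: i_inj; rewrite {1}ix linear_sum; apply: eq_bigr => j _.
by rewrite linearZ /= (nth_map 0).
Qed.

End Generators.

(** * Semi-inner products and orthogonal correction *)

Section SemiInnerProduct.
Variables (R : realFieldType) (V : lmodType R) (Q : V -> V -> R).
Hypothesis QP : forall a x y z, Q (a *: x + y) z = a * Q x z + Q y z.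
Hypothesis Qsym : forall x y, Q x y = Q y x.
Hypothesis Qge0 : forall x, 0 <= Q x x.

(** Degenerate Cauchy-Schwarz: [Q (t *: e + x) (t *: e + x)] is affine in [t], so nonnegativity
    forces its slope to vanish. *)
Lemma semi_inner_eq0 x e : Q e e = 0 -> Q x e = 0.
Proof.
move=> e0; apply/eqP/negP => /negP xe0.
(* Chosen so that the affine function takes the value -1. *)
pose t := - (Q x x + 1) / (Q x e *+ 2).
have: 0 <= Q (t *: e + x) (t *: e + x) by [].
rewrite QP [Q e _]Qsym QP e0 [Q x (_ + _)]Qsym QP mulr0 add0r [Q e x]Qsym.
rewrite addrA -mulr2n -mulrnAr mulfVK ?mulrn_eq0 //.
by rewrite opprD addrAC addNr add0r oppr_ge0 real_leNgt ?num_real // ltr01.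
Qed.

Let Q0 z : Q 0 z = 0.
Proof. by have := QP (-1) 0 0 z; rewrite scaler0 addr0 mulN1r addNr. Qed.

Let QD x y z : Q (x + y) z = Q x z + Q y z.
Proof. by rewrite -[x in LHS]scale1r QP mul1r. Qed.

Let QZ a x z : Q (a *: x) z = a * Q x z.
Proof. by rewrite -[a *: x]addr0 QP Q0 addr0. Qed.

(* The last clause of the conclusion stands for [y] being in the span of [s]. *)
Lemma orthogonal_correction_seq (P : V -> Prop) (s : seq V) :
  P 0 -> (forall a x y, P x -> P y -> P (a *: x + y)) ->
  (forall e, e \in s -> P e) ->
  forall x, exists y,
    [/\ P y, forall e, e \in s -> Q (x + y) e = 0 &
        forall f, (forall e, e \in s -> Q f e = 0) -> Q f y = 0].
Proof.
move=> P0 PL; elim: s => [|e s IHs] Ps x.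
  by exists 0; split=> // f _; rewrite Qsym.
have {}IHs := IHs (fun e' (s_e' : e' \in s) => Ps e' (mem_behead (s := e :: s) s_e')).
(* Gram-Schmidt: [y] corrects [x] and [z] corrects [e] against [s]; then [x + y] is corrected along
   [e + z]. *)
have [y [Py xy0 s_y]] := IHs x; have [z [Pz ez0 s_z]] := IHs e.
have Pez : P (e + z) by rewrite -[e]scale1r; apply: PL => //; apply/Ps/mem_head.
pose c := - Q (x + y) (e + z) / Q (e + z) (e + z).
have orth f : f \in s -> Q (x + (c *: (e + z) + y)) f = 0.
  by move=> sf; rewrite addrCA QP ez0 // xy0 // mulr0 addr0.
exists (c *: (e + z) + y); split=> [|f|f f0]; first exact: PL.
- rewrite inE => /predU1P[->|]; last exact: orth.
  (* Orthogonality to [e + z] yields that to [e], since the span clause for [z] kills the [z] part.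
     If [e + z] is a null vector, [semi_inner_eq0] applies whatever [c] is. *)
  have : Q (x + (c *: (e + z) + y)) (e + z) = 0.
    rewrite addrCA QP.
    have [ez|ez] := eqVneq (Q (e + z) (e + z)) 0; last by rewrite divfK // addNr.
    by rewrite ez mulr0 add0r semi_inner_eq0.
  by rewrite Qsym QD ![Q _ (x + _)]Qsym (s_z _ orth) addr0.
- have f_s e' : e' \in s -> Q f e' = 0 by move=> se'; apply: f0; rewrite inE se' orbT.
  rewrite Qsym QP QD ![Q _ f]Qsym (s_y f f_s) (s_z f f_s) !addr0.
  by rewrite f0 ?mulr0 // mem_head.
Qed.

(** Correction against a finite generating list of [P] extends to all of [P] by linearity. *)
Lemma orthogonal_correction (vT : vectType R) (i : {linear V -> vT}) (P : V -> Prop) :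
  injective i -> P 0 -> (forall a x y, P x -> P y -> P (a *: x + y)) ->
  forall x, exists2 y, P y & forall z, P z -> Q (x + y) z = 0.
Proof.
move=> i_inj P0 PL x; have [s Ps s_gen] := finite_generators P i_inj.
have [y [Py s_y _]] := orthogonal_correction_seq P0 PL Ps x.
exists y => // _ /s_gen[c ->]; rewrite Qsym.
elim/big_ind: _ => [//|u v u0 v0|j _]; first by rewrite QD u0 v0 addr0.
by rewrite QZ Qsym s_y ?mulr0 ?mem_nth.
Qed.

End SemiInnerProduct.

(** * Tuples: splitting off the head and moving an entry to the front *)

Section Tuples.
Variable T : finType.

Lemma reorderK n (s : 'S_n) : cancel (@reorder n T s) (reorder s^-1).
Proof. by move=> v; apply: eq_from_tnth => i; rewrite !tnth_mktuple permKV. Qed.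

Lemma omit0_cons n u (v : n.-tuple T) : omit ord0 (cons_tuple u v) = v.
Proof. by apply: eq_from_tnth => i; rewrite tnth_mktuple tnthS. Qed.

Lemma cons_omit0 n (v : n.+1.-tuple T) : cons_tuple (tnth v ord0) (omit ord0 v) = v.
Proof.
apply: eq_from_tnth => i; case: (unliftP ord0 i) => [j|] ->; last by rewrite tnth0.
by rewrite tnthS tnth_mktuple.
Qed.

Lemma sum_cons_tuple (R : nmodType) n (F : n.+1.-tuple T -> R) :
  \sum_v F v = \sum_u \sum_(v : n.-tuple T) F (cons_tuple u v).
Proof.
rewrite pair_bigA /= (reindex (fun p : T * n.-tuple T => cons_tuple p.1 p.2)) //.
exists (fun v => (tnth v ord0, omit ord0 v)) => [[u v]|v] _ /=.
  by rewrite tnth0 omit0_cons.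
exact: cons_omit0.
Qed.

(* [reorder (front j) v] is [(v_j, v_0, .., \hat v_j, .., v_n)]. *)
Definition front n (j : 'I_n.+1) : 'S_n.+1 := lift_perm ord0 j 1%g.

Lemma reorder_front n (j : 'I_n.+1) (v : n.+1.-tuple T) :
  reorder (front j) v = cons_tuple (tnth v j) (omit j v).
Proof.
apply: eq_from_tnth => i; rewrite tnth_mktuple.
case: (unliftP ord0 i) => [l|] ->; last by rewrite lift_perm_id tnth0.
by rewrite lift_perm_lift tnthS tnth_mktuple perm1.
Qed.

Lemma sign_front (R : pzRingType) n (j : 'I_n.+1) : (-1) ^+ front j = (-1) ^+ j :> R.
Proof. by rewrite odd_lift_perm odd_perm1 addbF addFb signr_odd. Qed.

Lemma sum_front (R : nmodType) n (j : 'I_n.+1) (F : n.+1.-tuple T -> R) :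
  \sum_v F (reorder (front j) v) = \sum_v F v.
Proof.
symmetry; apply: reindex; exists (reorder (front j)^-1%g) => v _; first exact: reorderK.
by rewrite -{1}[front j]invgK reorderK.
Qed.

End Tuples.

(** * The inner product on forms and the explicit codifferential *)

Section InnerProduct.
Variables (R : realType) (G : sgraph) (w : weight R G).

Lemma kform_linE k (x : R) (a b : kform R G k) v : (x *: a + b) v = x * a v + b v.
Proof. by rewrite !ffunE. Qed.

Lemma kform_skew k (a : kform R G k) s v : a (reorder s v) = (-1) ^+ s * a v.
Proof. by have [] := form_predP _ (form_valP a). Qed.

Lemma kform_supp k (a : kform R G k) v : [set x in v] \notin cliques G k.+1 -> a v = 0.
Proof. by have [_] := form_predP _ (form_valP a); apply. Qed.

Lemma innerP k x (a b c : kform R G k) :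
  inner w (x *: a + b) c = x * inner w a c + inner w b c.
Proof.
rewrite /inner mulrCA -mulrDr [x * _]mulr_sumr -big_split /=; congr (_ * _).
by apply: eq_bigr => v _; rewrite kform_linE !mulrDl !mulrA.
Qed.

Lemma innerC k (a b : kform R G k) : inner w a b = inner w b a.
Proof. by congr (_ * _); apply: eq_bigr => v _; rewrite [a v * _]mulrC. Qed.

Lemma innerDl k (a b c : kform R G k) : inner w (a + b) c = inner w a c + inner w b c.
Proof. by rewrite -[a in LHS]scale1r innerP mul1r. Qed.

Lemma inner0l k (a : kform R G k) : inner w 0 a = 0.
Proof. by apply: (addrI (inner w 0 a)); rewrite -innerDl !addr0. Qed.

Lemma weight_ge0 k v : 0 <= w k v.
Proof.
have [/(weight_pos w)/ltW //|/(weight_eq0 w) ->//] := boolP ([set x in v] \in cliques G k.+1).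
Qed.

Lemma inner_ge0 k (a : kform R G k) : 0 <= inner w a a.
Proof.
apply: mulr_ge0; first by rewrite invr_ge0.
by apply: sumr_ge0 => v _; rewrite mulr_ge0 ?weight_ge0 // -expr2 sqr_ge0.
Qed.

Lemma inner_eq0 k (a : kform R G k) : inner w a a = 0 -> a = 0.
Proof.
move=> /eqP; rewrite mulf_eq0 invr_eq0 pnatr_eq0 -leqn0 leqNgt fact_gt0 /= psumr_eq0.
  move=> /allP a0; apply/val_inj/ffunP => v; rewrite !ffunE /=.
  have [vG|/kform_supp-> //] := boolP ([set x in v] \in cliques G k.+1).
  have := a0 v (mem_index_enum _); rewrite mulf_eq0 (gt_eqF (weight_pos w vG)) orbF.
  by rewrite -expr2 sqrf_eq0 => /eqP.
by move=> v _; rewrite mulr_ge0 ?weight_ge0 // -expr2 sqr_ge0.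
Qed.

Lemma inner_inj k (a b : kform R G k) :
  (forall c, inner w a c = inner w b c) -> a = b.
Proof.
move=> ab; apply/eqP; rewrite -subr_eq0; apply/eqP/inner_eq0.
by rewrite -scaleN1r addrC innerP ab mulN1r addNr.
Qed.

Lemma form_val_is_linear k : linear (@form_val R G k).
Proof. by []. Qed.
HB.instance Definition _ k :=
  GRing.isLinear.Build R (kform R G k) {ffun k.+1.-tuple G -> R^o} _
    (@form_val R G k) (@form_val_is_linear k).

Lemma ext_diff_is_linear k : linear (@ext_diff R G k).
Proof.
move=> x a b; apply/val_inj/ffunP => v; rewrite kform_linE !ffunE.
case: ifP => _; last by rewrite mulr0 addr0.
rewrite mulr_sumr -big_split /=; apply: eq_bigr => j _.
by rewrite kform_linE mulrDr mulrCA.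
Qed.
HB.instance Definition _ k :=
  GRing.isLinear.Build R (kform R G k) (kform R G k.+1) _ (@ext_diff R G k)
    (@ext_diff_is_linear k).

(** Explicit candidate for the adjoint of [ext_diff]; it shows that the choice made by [codiff] is
    from a nonempty set. *)
Definition codiff_fun k (a : kform R G k.+1) : {ffun k.+1.-tuple G -> R^o} :=
  [ffun v : k.+1.-tuple G => if [set x in v] \in cliques G k.+1
     then (w k v)^-1 * \sum_u a (cons_tuple u v) * w k.+1 (cons_tuple u v) else 0].

Lemma codiff_subproof k (a : kform R G k.+1) : codiff_fun a \in @form_pred R G k.
Proof.
apply/form_predP; split=> [s v|v /negPf nv]; last by rewrite ffunE nv.
rewrite !ffunE reorder_set; case: ifP => _; last by rewrite mulr0.
rewrite weight_sym [RHS]mulrCA; congr (_ * _); rewrite mulr_sumr.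
apply: eq_bigr => u _; rewrite reorder_cons kform_skew weight_sym.
by rewrite odd_lift_perm addbb addFb mulrA.
Qed.

Lemma inner_codiff_form k (a : kform R G k.+1) (c : kform R G k) :
  inner w (Form (codiff_subproof a)) c = inner w a (ext_diff c).
Proof.
pose F v := a v * c (omit ord0 v) * w k.+1 v.
have -> : inner w a (ext_diff c) = (k.+1)`!%:R^-1 * \sum_v F v.
  (* With the omitted vertex moved to the front, the sign in [ext_diff] cancels that of [front j].
     All [k.+2] terms then have the same sum, which turns 1/(k+2)! into 1/(k+1)!. *)
  transitivity ((k.+2)`!%:R^-1 * \sum_v \sum_(j < k.+2) F (reorder (front j) v)).
    congr (_ * _); apply: eq_bigr => v _.
    have [vG|/(weight_eq0 w) wv] := boolP ([set x in v] \in cliques G k.+2); last first.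
      by rewrite wv mulr0 big1 // => j _; rewrite /F weight_sym wv mulr0.
    rewrite ffunE vG mulr_sumr mulr_suml; apply: eq_bigr => j _.
    rewrite /F weight_sym kform_skew sign_front reorder_front omit0_cons.
    by rewrite [a v * _]mulrCA !mulrA.
  rewrite exchange_big /= (eq_bigr _ (fun j _ => sum_front j F)) sumr_const card_ord.
  rewrite factS natrM invfM -[(\sum_v F v) *+ _]mulr_natl.
  by rewrite mulrACA mulVf ?pnatr_eq0 // mul1r.
congr (_ * _); rewrite [RHS]sum_cons_tuple [RHS]exchange_big /=; apply: eq_bigr => v _.
rewrite ffunE; case: ifP => [vG|/negbT/kform_supp cv]; last first.
  by rewrite !mul0r big1 // => u _; rewrite /F omit0_cons cv mulr0 mul0r.
rewrite mulrC !mulrA mulfV ?(gt_eqF (weight_pos w vG)) // mul1r.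
by rewrite mulr_suml; apply: eq_bigr => u _; rewrite /F omit0_cons mulrAC.
Qed.

(** An adjoint exists by [inner_codiff_form] and is unique because the inner product is definite. *)
Lemma codiffE k (a : kform R G k.+1) : codiff w a = Form (codiff_subproof a).
Proof.
apply: inner_inj => c; rewrite inner_codiff_form.
apply: (@xgetPex _ 0 [set b | forall c, inner w b c = inner w a (ext_diff c)]%classic).
by exists (Form (codiff_subproof a)) => d; exact: inner_codiff_form.
Qed.

Lemma inner_codiff k (a : kform R G k.+1) (c : kform R G k) :
  inner w (codiff w a) c = inner w a (ext_diff c).
Proof. by rewrite codiffE inner_codiff_form. Qed.

Lemma codiff_is_linear k : linear (@codiff R G w k).
Proof.
by move=> x a b; apply: inner_inj => c; rewrite !(innerP, inner_codiff).
Qed.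
HB.instance Definition _ k :=
  GRing.isLinear.Build R (kform R G k.+1) (kform R G k) _ (@codiff R G w k)
    (@codiff_is_linear k).

End InnerProduct.

(** * Boundary cliques as arguments in B x Omega^k *)

Section BoundaryArguments.
Variables (G : bgraph) (k : nat).

Lemma clique_adj n (v : n.-tuple G) i j :
  [set x in v] \in cliques G n -> i != j -> adj (tnth v i) (tnth v j).
Proof.
rewrite inE => /andP[]; rewrite cardsE => /eqP card_v /forallP v_adj ij.
have v_uniq : uniq v by apply/card_uniqP; rewrite card_v size_tuple.
have := v_adj (tnth v i); rewrite inE mem_tnth => /forallP/(_ (tnth v j)).
by rewrite inE mem_tnth /= (inj_eq (tuple_uniqP _ v_uniq)) ij.
Qed.

Lemma bargs_head v (vs : k.-tuple (ivertex G)) : tnth (bargs v vs) ord0 = val v.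
Proof. exact: tnth0. Qed.

Lemma bargs_tail v (vs : k.-tuple (ivertex G)) j :
  tnth (bargs v vs) (lift ord0 j) = val (tnth vs j).
Proof. by rewrite tnthS tnth_map. Qed.

Lemma bargs_inj v u (vs us : k.-tuple (ivertex G)) :
  bargs v vs = bargs u us -> (v, vs) = (u, us).
Proof.
move=> e; congr (_, _); first by apply/val_inj; rewrite -(bargs_head v vs) e bargs_head.
by apply/eq_from_tnth => j; apply/val_inj; rewrite -(bargs_tail v) e bargs_tail.
Qed.

(** No two boundary vertices are adjacent, so a clique headed in B has its tail in Omega. *)
Lemma bargs_clique (v : k.+1.-tuple G) :
  [set x in v] \in cliques G k.+1 -> tnth v ord0 \in bdry G ->
  exists p : bvertex G * k.-tuple (ivertex G), v = bargs p.1 p.2.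
Proof.
move=> vG v0B.
have vO j : tnth v (lift ord0 j) \in Omega G.
  rewrite inE; apply/negP => vjB.
  by have := bdry_indep v0B vjB; rewrite clique_adj // neq_lift.
exists (Sub (tnth v ord0) v0B, [tuple Sub (tnth v (lift ord0 j)) (vO j) | j < k]).
apply: eq_from_tnth => i; case: (unliftP ord0 i) => [j|] -> /=.
  by rewrite bargs_tail tnth_mktuple SubK.
by rewrite bargs_head SubK.
Qed.

Lemma sum_bargs (R : nmodType) (F : k.+1.-tuple G -> R) :
  (forall v, [set x in v] \notin cliques G k.+1 -> F v = 0) ->
  \sum_(v | tnth v ord0 \in bdry G) F v =
  \sum_(x : bvertex G) \sum_(vs : k.-tuple (ivertex G)) F (bargs x vs).
Proof.
move=> F0; rewrite pair_bigA /=.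
rewrite (bigID (fun v : k.+1.-tuple G => [set x in v] \in cliques G k.+1)) /=.
rewrite [X in _ + X]big1 ?addr0 => [|v /andP[_ /F0 //]].
rewrite [RHS](bigID (fun p => [set x in bargs p.1 p.2] \in cliques G k.+1)) /=.
rewrite [X in _ = _ + X]big1 ?addr0 => [|p /F0 //].
pose h (p : bvertex G * k.-tuple (ivertex G)) := bargs p.1 p.2.
(* Partial inverse of [h]; it is defined on every clique headed in B, by [bargs_clique]. *)
pose h' v := [pick p | h p == v].
rewrite (reindex_omap h h') => [|v /andP[v0B vG]].
  apply: eq_bigl => -[x vs] /=; rewrite bargs_head (valP x) /=.
  rewrite andb_idr // => _; rewrite /h'.
  by case: pickP => [[y us] /eqP/bargs_inj->//|/(_ (x, vs))]; rewrite eqxx.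
have [p vp] := bargs_clique vG v0B; rewrite /h' /=.
by case: pickP => [p' /eqP /= <-//|/(_ p)]; rewrite vp eqxx.
Qed.
End BoundaryArguments.

(** * Extending boundary data to a form on the whole graph *)

Section RestrictionSurjective.
Variables (R : realType) (G : bgraph) (k : nat) (phi : bkform R G k).

(** Extension of [phi] by zero to all tuples: by [bargs_inj] the sum has at most one term. It is
    skew only under permutations that fix the head. *)
Let phi0 (v : k.+1.-tuple G) : R :=
  \sum_(p : bvertex G * k.-tuple (ivertex G) | bargs p.1 p.2 == v) phi p.

Let phi0_skew (t : 'S_k) v :
  phi0 (reorder (lift_perm ord0 ord0 t) v) = (-1) ^+ t * phi0 v.
Proof.
have [skew _] := bform_predP _ (bform_valP phi).
pose h (p : bvertex G * k.-tuple (ivertex G)) := (p.1, reorder t p.2).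
rewrite /phi0 (reindex h) /= => [|].
  rewrite mulr_sumr; apply: eq_big => [[x vs]|[x vs] _] /=; last exact: skew.
  by rewrite reorder_bargs (can_eq (@reorderK _ _ _)).
exists (fun p => (p.1, reorder t^-1 p.2)) => -[x vs] _; congr (_, _); rewrite /= ?reorderK //.
by rewrite -{1}[t]invgK reorderK.
Qed.

(** Alternating over the vertex placed in front makes the extension skew in all variables. *)
Definition extend_fun : {ffun k.+1.-tuple G -> R^o} :=
  [ffun v : k.+1.-tuple G => \sum_(j < k.+1) (-1) ^+ j * phi0 (reorder (front j) v)].

Lemma extend_subproof : extend_fun \in @form_pred R G k.
Proof.
apply/form_predP; split=> [s v|v nv]; rewrite !ffunE.
  rewrite mulr_sumr [RHS](reindex_inj (@perm_inj _ s)) /=.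
  apply: eq_bigr => j _; have [t st] := lift_perm_omit s j.
  rewrite !reorder_front (omit_reorder _ st) tnth_mktuple reorder_cons phi0_skew.
  rewrite [in RHS]mulrCA !mulrA; congr (_ * _).
  have -> : (-1) ^+ s = (-1) ^+ j * (-1) ^+ s j * (-1) ^+ t :> R.
    by rewrite st odd_lift_perm !signr_addb !signr_odd -st.
  rewrite mulrA; congr (_ * _).
  by rewrite mulrCA -expr2 sqrr_sign mulr1.
have [_ supp] := bform_predP _ (bform_valP phi).
apply: big1 => j _; rewrite /phi0 big1 ?mulr0 // => -[x vs] /eqP e; apply: supp.
by rewrite bcliques_bargs e reorder_set.
Qed.

(** Only [j = ord0] survives: any other [j] puts an interior vertex in front. *)
Lemma restr_extend : restr_bdry (Form extend_subproof) = phi.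
Proof.
apply/val_inj/ffunP => -[x vs]; rewrite !ffunE /=.
rewrite (bigD1 ord0) //= [X in _ + X]big1 => [|j j0].
  rewrite addr0 expr0 mul1r reorder_front tnth0 omit0_cons /phi0 (big_pred1 (x, vs)) //.
  move=> p /=; apply/eqP/eqP => [/bargs_inj|->//].
  by case: p.
rewrite /phi0 big1 ?mulr0 // => -[y us] /eqP /= /(congr1 (fun v => tnth v ord0)).
rewrite bargs_head reorder_front tnth0; case: (unliftP ord0 j) j0 => [i ->|->//] _.
rewrite bargs_tail => e; have := valP (tnth vs i).
by rewrite -e inE (valP y).
Qed.
End RestrictionSurjective.

(** * Restriction, truncation and the boundary operators *)

Section Boundary.
Variables (R : realType) (G : bgraph) (w : weight R G).

Lemma restr_bdry_is_linear k : linear (@restr_bdry R G k).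
Proof. by move=> x a b; apply/val_inj/ffunP => p; rewrite !ffunE. Qed.
HB.instance Definition _ k :=
  GRing.isLinear.Build R (kform R G k) (bkform R G k) _ (@restr_bdry R G k)
    (@restr_bdry_is_linear k).

(** Cliques inside Omega contribute nothing, and every other clique has exactly one boundary vertex.
    Moving it to the front from its [k.+1] possible places turns 1/(k+1)! into 1/k!. *)
Lemma inner_zero_in k (a b : kform R G k) :
  zero_in a -> inner w a b = binner w (restr_bdry a) (restr_bdry b).
Proof.
move=> a0; pose F v : R := a v * b v * w k v.
pose F0 v := if tnth v ord0 \in bdry G then F v else 0.
have F_supp v : [set x in v] \notin cliques G k.+1 -> F v = 0.
  by move=> nv; rewrite /F kform_supp // !mul0r.
have F_reorder s v : F (reorder s v) = F v.
  by rewrite /F weight_sym !kform_skew mulrACA -expr2 sqrr_sign mul1r.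
rewrite /inner; have -> : \sum_v a v * b v * w k v = \sum_v \sum_j F0 (reorder (front j) v).
  apply: eq_bigr => v _; rewrite -/(F v) /F0.
  have [vG|nv] := boolP ([set x in v] \in cliques G k.+1); last first.
    by rewrite F_supp // big1 // => j _; rewrite F_reorder F_supp // if_same.
  have [vO|/subsetPn[x]] := boolP ([set x in v] \subset Omega G).
    rewrite /F a0 // !mul0r big1 // => j _; rewrite reorder_front tnth0.
    have := fintype.subsetP vO (tnth v j); rewrite !inE mem_tnth => /(_ isT)/negPf-> //.
  rewrite inE => /tnthP[j ->]; rewrite inE negbK => vjB.
  rewrite (bigD1 j) //= F_reorder reorder_front tnth0 vjB big1 ?addr0 // => i ij.
  rewrite reorder_front tnth0; case: ifP => // viB.
  by have := bdry_indep viB vjB; rewrite clique_adj.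
rewrite exchange_big /= (eq_bigr _ (fun j _ => sum_front j F0)) sumr_const card_ord.
rewrite -big_mkcond (sum_bargs F_supp) factS natrM invfM.
rewrite -[(\sum_x _) *+ _]mulr_natl mulrACA mulVf ?pnatr_eq0 // mul1r.
congr (_ * _); apply: eq_bigr => x _; apply: eq_bigr => vs _.
by rewrite !ffunE.
Qed.

Lemma inner_zero_restr k (a b : kform R G k) :
  zero_in a -> restr_bdry b = 0 -> inner w a b = 0.
Proof.
move=> a0 b0; rewrite (inner_zero_in b a0) b0 /binner big1 ?mulr0 // => x _.
by apply: big1 => vs _; rewrite !ffunE mulr0 mul0r.
Qed.

Lemma binnerC k (a b : bkform R G k) : binner w a b = binner w b a.
Proof.
congr (_ * _); apply: eq_bigr => v _; apply: eq_bigr => vs _.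
by rewrite [a _ * _]mulrC.
Qed.

(** The map t of the overview, an orthogonal projection by [inner_trunc]. It turns [zero_in] into a
    linear equation, by [trunc_zero_in]. *)
Definition trunc_fun k (a : kform R G k) : {ffun k.+1.-tuple G -> R^o} :=
  [ffun v : k.+1.-tuple G => if [set x in v] \subset Omega G then a v else 0].

Lemma trunc_subproof k (a : kform R G k) : trunc_fun a \in @form_pred R G k.
Proof.
apply/form_predP; split=> [s v|v nv]; rewrite !ffunE ?reorder_set.
  by case: ifP; rewrite ?kform_skew ?mulr0.
by rewrite kform_supp ?if_same.
Qed.

Definition trunc k (a : kform R G k) : kform R G k := Form (trunc_subproof a).

Lemma trunc_is_linear k : linear (@trunc k).
Proof.
move=> x a b; apply/val_inj/ffunP => v; rewrite kform_linE !ffunE.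
by case: ifP; rewrite ?mulr0 ?addr0.
Qed.
HB.instance Definition _ k :=
  GRing.isLinear.Build R (kform R G k) (kform R G k) _ (@trunc k) (@trunc_is_linear k).

Lemma trunc_zero_in k (a : kform R G k) : zero_in a <-> trunc a = 0.
Proof.
split=> [a0|/(congr1 (@form_val _ _ _))/ffunP a0 v vG vO].
  apply/val_inj/ffunP => v; rewrite !ffunE; case: ifP => // vO.
  have [vG|/kform_supp-> //] := boolP ([set x in v] \in cliques G k.+1).
  exact: a0.
by have := a0 v; rewrite !ffunE vO.
Qed.

Lemma restr_trunc k (a : kform R G k) : restr_bdry (trunc a) = 0.
Proof.
apply/val_inj/ffunP => -[x vs]; rewrite !ffunE /=; case: ifP => // /fintype.subsetP/(_ (val x)).
by rewrite !inE eqxx (valP x) => /(_ isT).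
Qed.

Lemma inner_trunc k (a b : kform R G k) : inner w (trunc a) b = inner w (trunc a) (trunc b).
Proof.
congr (_ * _); apply: eq_bigr => v _; rewrite !ffunE.
by case: ifP; rewrite ?mul0r.
Qed.

(** The faces of a clique inside Omega stay inside Omega. *)
Lemma trunc_ext_diff k (a : kform R G k) :
  trunc (ext_diff (trunc a)) = trunc (ext_diff a).
Proof.
apply/val_inj/ffunP => v; rewrite !ffunE; case: ifP => // /fintype.subsetP vO; case: ifP => // _.
apply: eq_bigr => j _; rewrite ffunE ifT //.
apply/fintype.subsetP => x; rewrite inE => /tnthP[i ->].
by apply: vO; rewrite tnth_mktuple inE mem_tnth.
Qed.

(** [codiff] sums over all vertices, but a boundary [u] cannot be adjacent to the boundary vertex
    [x], so only [u] in Omega counts. *)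
Lemma NopE k (a : kform R G k.+1) : Nop w a = restr_bdry (codiff w a).
Proof.
rewrite codiffE; apply/val_inj/ffunP => -[x vs]; rewrite !ffunE /= bcliques_bargs.
case: ifP => // _; congr (_ * _).
rewrite [RHS](bigID [in Omega G]) /= [X in _ = _ + X]big1 ?addr0 // => u.
rewrite inE negbK => uB; rewrite kform_supp ?mul0r //; apply/negP => uG.
have := bdry_indep uB (valP x); rewrite -(bargs_head x vs).
have := clique_adj uG (neq_lift ord0 ord0).
by rewrite tnth0 tnthS => ->.
Qed.

(** Only the face omitting the head lies in Omega; every other face keeps the boundary vertex and is
    truncated to 0. *)
Lemma DopE k (a : kform R G k) : Dop a = restr_bdry (ext_diff (trunc a)).
Proof.
apply/val_inj/ffunP => -[x vs]; rewrite !ffunE /= bcliques_bargs; case: ifP => // _.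
rewrite big_ord_recl expr0 mul1r big1 ?addr0 => [|j _].
  rewrite ffunE omit0_cons ifT //; apply/fintype.subsetP => y; rewrite inE => /mapP[z _ ->].
  exact: valP.
rewrite ffunE ifF ?mulr0 //; apply/negP => /fintype.subsetP/(_ (val x)).
rewrite !inE (valP x) => /(_ _)/negP; apply => //.
apply/tnthP; exists ord0; rewrite tnth_mktuple.
have -> : lift (lift ord0 j) ord0 = ord0 :> 'I_k.+2 by apply/val_inj.
by rewrite bargs_head.
Qed.

End Boundary.

(** * The Dirichlet problem and its boundary map for an abstract operator [L] *)

Section DirichletToNeumann.
Variables (R : realType) (G : bgraph) (w : weight R G) (k : nat).
Variable L : {linear kform R G k -> kform R G k}.
Hypothesis L_sym : forall a b, inner w (L a) b = inner w a (L b).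
Hypothesis L_ge0 : forall a, 0 <= inner w (L a) a.

Let Q a b := inner w (L a) b.

Let QP x a b c : Q (x *: a + b) c = x * Q a c + Q b c.
Proof. by rewrite /Q linearP innerP. Qed.

Let Qsym a b : Q a b = Q b a.
Proof. by rewrite /Q L_sym innerC. Qed.

Lemma energy_eq0 a : inner w (L a) a = 0 -> L a = 0.
Proof.
move=> a0; apply: (@inner_inj _ _ w) => b.
by rewrite inner0l -/(Q a b) Qsym (semi_inner_eq0 QP Qsym L_ge0).
Qed.

Lemma dirichlet_solvable (phi : bkform R G k) :
  exists a, zero_in (L a) /\ restr_bdry a = phi.
Proof.
pose P (a : kform R G k) := restr_bdry a = 0.
have PL x a b : P a -> P b -> P (x *: a + b).
  by rewrite /P linearP /= => -> ->; rewrite scaler0 addr0.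
have [b Pb b_orth] :=
  orthogonal_correction QP Qsym L_ge0 (i := @form_val R G k) val_inj
    (linear0 _ : P 0) PL (Form (extend_subproof phi)).
exists (Form (extend_subproof phi) + b); split; last first.
  by rewrite linearD /= restr_extend Pb addr0.
apply/trunc_zero_in/(@inner_eq0 _ _ w).
(* The test form is [trunc (L a)] itself, which has zero restriction. *)
by rewrite -inner_trunc innerC; apply: b_orth; exact: restr_trunc.
Qed.

Lemma dirichlet_unique (a : kform R G k) :
  zero_in (L a) -> restr_bdry a = 0 -> L a = 0.
Proof. by move=> La a0; apply/energy_eq0/inner_zero_restr. Qed.

Variables (E : bkform R G k -> kform R G k) (T : bkform R G k -> bkform R G k).
(** The equation as originally posed. It may come from an operator other than [L] that agrees with
    [L] only on the cliques of Omega. *)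
Variable sol : kform R G k -> Prop.
Hypothesis solP : forall a, sol a <-> zero_in (L a).
Hypothesis EE : forall phi,
  E phi = xget 0 [set a | sol a /\ restr_bdry a = phi]%classic.
Hypothesis TE : forall phi, T phi = restr_bdry (L (E phi)).

Let E_sol phi : zero_in (L (E phi)) /\ restr_bdry (E phi) = phi.
Proof.
have [a [/solP La ra]] := dirichlet_solvable phi.
have [] : sol (E phi) /\ restr_bdry (E phi) = phi.
  rewrite EE; apply: (@xgetPex _ 0 [set a | sol a /\ restr_bdry a = phi]%classic).
  by exists a.
by move=> /solP.
Qed.

(** Independence of the chosen solution: two solutions with the same data differ by an element of
    the kernel of [L]. *)
Let L_E a phi : zero_in (L a) -> restr_bdry a = phi -> L (E phi) = L a.
Proof.
move=> La a_phi; have [LE E_phi] := E_sol phi.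
apply/eqP; rewrite -subr_eq0 -linearB; apply/eqP/dirichlet_unique.
  by apply/trunc_zero_in; move/trunc_zero_in: La => La; move/trunc_zero_in: LE => LE;
     rewrite !linearB /= LE La subrr.
by rewrite linearB /= E_phi a_phi subrr.
Qed.

Let binner_T phi psi : binner w (T phi) psi = Q (E phi) (E psi).
Proof.
have [LE _] := E_sol phi; have [_ E_psi] := E_sol psi.
by rewrite TE -[in LHS]E_psi -inner_zero_in.
Qed.

Lemma dn_nonneg_self_adjoint : nonneg_self_adjoint w T.
Proof.
split=> [x phi psi|phi psi|phi]; last by rewrite binner_T; exact: L_ge0.
  have [LE_phi E_phi] := E_sol phi; have [LE_psi E_psi] := E_sol psi.
  (* The choice [E] need not be linear, but this combination solves the problem with the combined
     data. *)
  rewrite !TE (@L_E (x *: E phi + E psi)) ?linearP //=; last by rewrite E_phi E_psi.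
  apply/trunc_zero_in; move/trunc_zero_in: LE_phi => LE_phi.
  by move/trunc_zero_in: LE_psi => LE_psi; rewrite !linearP /= LE_phi LE_psi scaler0 addr0.
by rewrite [RHS]binnerC !binner_T Qsym.
Qed.

Lemma dn_kernel :
  op_kernel T = [set restr_bdry a | a in [set a : kform R G k | L a = 0]]%classic.
Proof.
apply/seteqP; split=> [phi /= T0|_ /= [a La <-]].
  exists (E phi); last by have [] := E_sol phi.
  apply: energy_eq0; rewrite -/(Q _ _) -binner_T T0 /binner big1 ?mulr0 // => x _.
  by apply: big1 => vs _; rewrite ffunE !mul0r.
(* Conversely, [a] solves the problem with its own restriction as data. *)
rewrite /op_kernel /= TE (@L_E a) // ?La ?linear0 //.
by apply/trunc_zero_in; rewrite linear0.
Qed.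

End DirichletToNeumann.

(** * The three operators: symmetry, nonnegativity and kernels *)

Section Operators.
Variables (R : realType) (G : bgraph) (w : weight R G).

(* Agrees with [d_delta w] on the cliques of Omega, but restricts to
   [Dop (codiff w a)] on the boundary cliques, which [d_delta w a] does not. *)
Definition d_delta_int k : kform R G k -> kform R G k :=
  if k is k'.+1 then fun a => ext_diff (trunc (codiff w a)) else fun=> 0.

Lemma d_delta_int_is_linear k : linear (@d_delta_int k).
Proof.
case: k => [|k] x a b; last by rewrite /d_delta_int !linearP.
by rewrite scaler0 addr0.
Qed.
HB.instance Definition _ k :=
  GRing.isLinear.Build R (kform R G k) (kform R G k) _ (@d_delta_int k)
    (@d_delta_int_is_linear k).

Lemma delta_d_is_linear k : linear (@delta_d R G w k).
Proof. by move=> x a b; rewrite /delta_d !linearP. Qed.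
HB.instance Definition _ k :=
  GRing.isLinear.Build R (kform R G k) (kform R G k) _ (@delta_d R G w k)
    (@delta_d_is_linear k).

Definition laplacian_int k (a : kform R G k) : kform R G k :=
  d_delta_int a + delta_d w a.

Lemma laplacian_int_is_linear k : linear (@laplacian_int k).
Proof.
by move=> x a b; rewrite /laplacian_int !linearP scalerDr addrACA.
Qed.
HB.instance Definition _ k :=
  GRing.isLinear.Build R (kform R G k) (kform R G k) _ (@laplacian_int k)
    (@laplacian_int_is_linear k).

Lemma inner_delta_d k (a b : kform R G k) :
  inner w (delta_d w a) b = inner w (ext_diff a) (ext_diff b).
Proof. exact: inner_codiff. Qed.

Lemma delta_d_sym k (a b : kform R G k) :
  inner w (delta_d w a) b = inner w a (delta_d w b).
Proof. by rewrite [RHS]innerC !inner_delta_d innerC. Qed.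

Lemma delta_d_ge0 k (a : kform R G k) : 0 <= inner w (delta_d w a) a.
Proof. by rewrite inner_delta_d inner_ge0. Qed.

Lemma delta_d_eq0 k (a : kform R G k) : delta_d w a = 0 <-> ext_diff a = 0.
Proof.
split=> [a0|da0]; last by rewrite /delta_d da0 linear0.
by apply: (@inner_eq0 _ _ w); rewrite -inner_delta_d a0 inner0l.
Qed.

Lemma inner_d_delta_int k (a b : kform R G k.+1) :
  inner w (d_delta_int a) b = inner w (trunc (codiff w a)) (trunc (codiff w b)).
Proof. by rewrite innerC -inner_codiff innerC inner_trunc. Qed.

Lemma d_delta_int_sym k (a b : kform R G k) :
  inner w (d_delta_int a) b = inner w a (d_delta_int b).
Proof.
case: k a b => [|k] a b; first by rewrite inner0l innerC inner0l.
by rewrite [RHS]innerC !inner_d_delta_int innerC.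
Qed.

Lemma d_delta_int_ge0 k (a : kform R G k) : 0 <= inner w (d_delta_int a) a.
Proof.
by case: k a => [|k] a; [rewrite inner0l | rewrite inner_d_delta_int inner_ge0].
Qed.

(** Pairing [d_delta_int a] with [a] gives the squared norm of [trunc (codiff w a)]; in degree 0
    both sides hold trivially. *)
Lemma d_delta_int_eq0 k (a : kform R G k) : d_delta_int a = 0 <-> coclosed_in w a.
Proof.
case: k a => [|k] a //=; rewrite -/(d_delta_int a); split=> [a0|/trunc_zero_in a0].
  apply/trunc_zero_in/(@inner_eq0 _ _ w).
  by rewrite -inner_d_delta_int a0 inner0l.
by rewrite /d_delta_int a0 linear0.
Qed.

Lemma trunc_d_delta_int k (a : kform R G k) : trunc (d_delta_int a) = trunc (d_delta w a).
Proof. by case: k a => [|k] a //=; exact: trunc_ext_diff. Qed.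

Lemma D_deltaE k (a : kform R G k) : D_delta w a = restr_bdry (d_delta_int a).
Proof. by case: k a => [|k] a; rewrite /= ?linear0 ?DopE. Qed.

Lemma laplacian_int_sym k (a b : kform R G k) :
  inner w (laplacian_int a) b = inner w a (laplacian_int b).
Proof.
rewrite [RHS]innerC /laplacian_int !innerDl d_delta_int_sym delta_d_sym.
by rewrite ![inner w a _]innerC.
Qed.

Lemma laplacian_int_ge0 k (a : kform R G k) : 0 <= inner w (laplacian_int a) a.
Proof. by rewrite innerDl addr_ge0 ?d_delta_int_ge0 ?delta_d_ge0. Qed.

(** The two energies are nonnegative with sum zero, so both vanish, and [energy_eq0] applies to each
    operator. *)
Lemma laplacian_int_eq0 k (a : kform R G k) :
  laplacian_int a = 0 <-> ext_diff a = 0 /\ coclosed_in w a.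
Proof.
split=> [a0|[/delta_d_eq0 da /d_delta_int_eq0 ca]]; last first.
  by rewrite /laplacian_int da ca addr0.
have := congr1 (fun b => inner w b a) a0; rewrite inner0l innerDl => /eqP.
rewrite paddr_eq0 ?d_delta_int_ge0 ?delta_d_ge0 // => /andP[/eqP c0 /eqP d0].
split; [apply/delta_d_eq0|apply/d_delta_int_eq0].
  exact: (energy_eq0 (@delta_d_sym k) (@delta_d_ge0 k)).
exact: (energy_eq0 (@d_delta_int_sym k) (@d_delta_int_ge0 k)).
Qed.

End Operators.

Local Open Scope classical_set_scope.

Theorem proposition3p3 (R : realType) (G : bgraph) (w : weight R G) (k : nat) :
  [/\ nonneg_self_adjoint w (@T_delta_d R G w k),
      nonneg_self_adjoint w (@T_d_delta R G w k) &
      nonneg_self_adjoint w (@T_laplacian R G w k)] /\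
  [/\ op_kernel (@T_delta_d R G w k) =
        [set restr_bdry a | a in [set a : kform R G k | ext_diff a = 0]],
      op_kernel (@T_d_delta R G w k) =
        [set restr_bdry a | a in [set a : kform R G k | coclosed_in w a]] &
      op_kernel (@T_laplacian R G w k) =
        [set restr_bdry a | a in [set a : kform R G k |
                               ext_diff a = 0 /\ coclosed_in w a]]].
Proof.
have T1 (phi : bkform R G k) : T_delta_d w phi = restr_bdry (delta_d w (E_delta_d w phi)).
  exact: NopE.
have T2 (phi : bkform R G k) :
    T_d_delta w phi = restr_bdry (d_delta_int w (E_d_delta w phi)).
  exact: D_deltaE.
have T3 (phi : bkform R G k) :
    T_laplacian w phi = restr_bdry (laplacian_int w (E_laplacian w phi)).
  by rewrite /T_laplacian NopE D_deltaE addrC -linearD.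
(* Replacing [d_delta] by [d_delta_int] leaves the interior equation unchanged, since both have the
   same truncation. *)
have S2 (a : kform R G k) : zero_in (d_delta w a) <-> zero_in (d_delta_int w a).
  by split=> /trunc_zero_in a0; apply/trunc_zero_in; move: a0; rewrite trunc_d_delta_int.
have S3 (a : kform R G k) : zero_in (laplacian w a) <-> zero_in (laplacian_int w a).
  by split=> /trunc_zero_in a0; apply/trunc_zero_in; move: a0;
     rewrite !linearD /= trunc_d_delta_int.
have S1 (a : kform R G k) := iff_refl (zero_in (delta_d w a)).
pose sym1 := @delta_d_sym R G w k; pose ge1 := @delta_d_ge0 R G w k.
pose sym2 := @d_delta_int_sym R G w k; pose ge2 := @d_delta_int_ge0 R G w k.
pose sym3 := @laplacian_int_sym R G w k; pose ge3 := @laplacian_int_ge0 R G w k.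
split; split.
- exact: (dn_nonneg_self_adjoint (L := @delta_d R G w k) sym1 ge1 S1 (fun=> erefl) T1).
- exact: (dn_nonneg_self_adjoint (L := @d_delta_int R G w k) sym2 ge2 S2 (fun=> erefl) T2).
- exact: (dn_nonneg_self_adjoint (L := @laplacian_int R G w k) sym3 ge3 S3 (fun=> erefl) T3).
- rewrite (dn_kernel (L := @delta_d R G w k) sym1 ge1 S1 (fun=> erefl) T1).
  by congr classical_sets.image; apply/eq_set => a; apply/propext/delta_d_eq0.
- rewrite (dn_kernel (L := @d_delta_int R G w k) sym2 ge2 S2 (fun=> erefl) T2).
  by congr classical_sets.image; apply/eq_set => a; apply/propext/d_delta_int_eq0.
- rewrite (dn_kernel (L := @laplacian_int R G w k) sym3 ge3 S3 (fun=> erefl) T3).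
  by congr classical_sets.image; apply/eq_set => a; apply/propext/laplacian_int_eq0.
Qed.
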